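(* Let $G$ be a continuous cumulative distribution function and let $P_N=\sum_{i=1}^{N}J_i\delta_{Y_i}$ be a discrete distribution, where $(Y_i)_{1\le i\le N}$ are i.i.d. from $H$. Let $Y_{(1)}\le\cdots\le Y_{(N)}$ be the order statistics of $(Y_i)_{1\le i\le N}$ and let $J_1',\ldots,J_N'$ be the associated jump sizes, such that $J_i=J_j'$ when $Y_i=Y_{(j)}$. Then the Anderson-Darling distance between $P_N$ and $G$ is given by $$ \begin{aligned} d_{AD}(P_N,G)={}&2\sum_{i=1}^{N-1}\sum_{j=1}^{i-1}\sum_{k=j+1}^{i}J_j'J_k'\,C_{i,i+1}+\sum_{i=1}^{N-1}\sum_{j=1}^{i}(J_j')^{2}C_{i,i+1}+2\sum_{i=1}^{N-1}\sum_{j=1}^{i}J_j'\,C^{*}_{i,i+1}\\ &-\sum_{i=1}^{N-1}C^{*}_{i,i+1}-\log\big[G(Y_{(N)})(1-G(Y_{(1)}))\big]-1, \end{aligned} $$ where $$C_{i,i+1}=\log\frac{G(Y_{(i+1)})\,(1-G(Y_{(i)}))}{G(Y_{(i)})\,(1-G(Y_{(i+1)}))},\qquad C^{*}_{i,i+1}=\log\frac{1-G(Y_{(i+1)})}{1-G(Y_{(i)})}.$$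
   Context: For cumulative distribution functions $F$ and $G$ on $\mathbb{R}$ (a probability distribution being identified with its cdf), the Anderson-Darling distance is $$d_{AD}(F,G)=\int_{-\infty}^{\infty}\frac{(F(t)-G(t))^2}{G(t)(1-G(t))}\,dG(t).$$ Here $\log$ is the natural logarithm, $N$ is a positive integer, $H$ is a probability distribution on $\mathbb{R}$, $\delta_y$ is the Dirac measure at $y$, and the weights $J_i$ of the discrete distribution $P_N$ are nonnegative and sum to $1$. *)

(* Defs.v *)
From HB Require Import structures.
From mathcomp Require Import all_boot all_order all_algebra perm.
From mathcomp Require Import all_classical all_reals all_analysis.

Set Implicit Arguments.
Unset Strict Implicit.
Unset Printing Implicit Defensive.

Import Order.TTheory GRing.Theory Num.Theory.
Import numFieldNormedType.Exports.

Local Open Scope classical_set_scope.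
Local Open Scope ring_scope.

(* The integrand is a quotient of extended reals, where x / 0 = +oo for x > 0
   and 0 / 0 = 0; when G is continuous, [set t | G t = 0 \/ G t = 1] is
   dG-negligible and the convention is immaterial. *)
Definition anderson_darling (R : realType) (F : R -> R)
    (G : cumulativeBounded (0 : R) (1 : R)) : \bar R :=
  (\int[lebesgue_stieltjes_measure G]_(t in [set: R])
     (((F t - G t) ^+ 2)%:E / (G t * (1 - G t))%:E))%E.

Definition discrete_distribution (R : realType) (N : nat) (J y : 'I_N -> R)
    (A : set R) : \bar R :=
  (\sum_(i < N) (J i)%:E * \d_(y i) A)%E.

Definition cdf_of (R : realType) (mu : set R -> \bar R) (t : R) : R :=
  fine (mu `]-oo, t]%classic).

(* Indices of order statistics run from 1 to N. *)
Definition order_stat (R : realType) (N : nat) (y : 'I_N -> R) (i : nat) : R :=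
  nth 0 (sort <=%R [seq y j | j <- enum 'I_N]) i.-1.

(* J' lists J in an order that sorts y; it is indexed from 1 to N, like
   order_stat. When y has ties several J' qualify, one per sorting
   permutation. *)
Definition associated_jumps (R : realType) (N : nat) (J y : 'I_N -> R)
    (J' : nat -> R) : Prop :=
  exists s : 'S_N, forall j : 'I_N,
    y (s j) = order_stat y j.+1 /\ J' j.+1 = J (s j).

Definition mutually_independent d (T : measurableType d) (R : realType)
    (P : probability T R) (N : nat) (Y : 'I_N -> {RV P >-> R}) : Prop :=
  forall (S : {set 'I_N}) (B : 'I_N -> set R),
    (forall i, i \in S -> measurable (B i)) ->
    P (\bigcap_(i in [set` S]) (Y i @^-1` B i)) =
    (\prod_(i in S) P (Y i @^-1` B i))%E.

Definition iid_from d (T : measurableType d) (R : realType)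
    (P : probability T R) (N : nat) (Y : 'I_N -> {RV P >-> R})
    (H : probability R R) : Prop :=
  mutually_independent Y /\
  forall (i : 'I_N) (A : set R), measurable A -> distribution P (Y i) A = H A.

(* In C_{i,i+1} and C*_{i,i+1}, a is Y_(i) and b is Y_(i+1). *)
Definition logC (R : realType) (G : R -> R) (a b : R) : R :=
  ln ((G b * (1 - G a)) / (G a * (1 - G b))).

Definition logCstar (R : realType) (G : R -> R) (a b : R) : R :=
  ln ((1 - G b) / (1 - G a)).

(* Main.v *)
Require Import Defs.
From HB Require Import structures.
From mathcomp Require Import all_boot all_order all_algebra perm.
From mathcomp Require Import all_classical all_reals all_analysis.
From mathcomp Require Import measurable_realfun ring lra.

(** The probability integral transform turns the integral against [dG] into a
    Lebesgue integral over [0 <= u <= 1]: since [G] is continuous, [G] pushes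
    [dG] forward to the uniform distribution, and the cdf of [P_N] at [t] is,
    outside a [dG]-null set, the step function [sum_i J_i [G(Y_i) <= u]] at
    [u = G t]. Between two consecutive values [G(Y_(i))] and [G(Y_(i+1))] this
    step function is a constant [c = J'_1 + ... + J'_i], and
    [(c - u)^2 / (u (1 - u))] has the primitive
    [c^2 (ln u - ln (1 - u)) + 2 c ln (1 - u) - ln (1 - u) - u]. On the first
    interval [c = 0] and on the last one [c = 1], so that the kernel has no
    singularity at [u = 0] or [u = 1]. *)

Set Implicit Arguments.
Unset Strict Implicit.
Unset Printing Implicit Defensive.

Import Order.TTheory GRing.Theory Num.Theory.
Import numFieldNormedType.Exports.

Local Open Scope classical_set_scope.
Local Open Scope ring_scope.

(** The intervals []a, b]] are stable under intersection and generate the Borel sets, and the []-n,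
    n]] exhaust the line. Each []a, b]] is a difference of two rays, so the values on rays determine
    the measure. *)
Lemma eq_probability_ray (R : realType)
    (P Q : probability (measurableTypeR R) R) :
  (forall x, P `]-oo, x]%classic = Q `]-oo, x]%classic) ->
  forall A, measurable A -> P A = Q A.
Proof.
move=> PQ A mA.
apply: (@measure_unique _ R (measurableTypeR R) (@ocitv R)
  (fun n : nat => `](- n%:R), n%:R]%classic) _ _ _ _ P Q) => //.
- exact: ocitvI.
- by move=> i; exact: is_ocitv.
- exact: (@bigcup_itvT R false false).
- move=> _ [[a b]] /= _ <-.
  have -> : `]a, b]%classic = `]-oo, b] `\` `]-oo, a].
    by rewrite -[RHS]setCK setCD setCitvl setUC -[LHS]setCK setCitv.
  have mI (x : R) : measurable (`]-oo, x]%classic : set (measurableTypeR R)).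
    exact: measurable_itv.
  (* The endpoints come in no prescribed order, so the intersection of the two rays is whichever is
     shorter. *)
  have PI : P (`]-oo, b] `&` `]-oo, a]) = Q (`]-oo, b] `&` `]-oo, a]).
    have [ab|/ltW ba] := leP a b.
      by rewrite setIidr //; apply: subset_itvl; rewrite bnd_simp.
    by rewrite setIidl //; apply: subset_itvl; rewrite bnd_simp.
  rewrite !measureD //; first by congr (_ - _)%E; [exact: PQ|exact: PI].
  - exact: (le_lt_trans (probability_le1 _ _) (ltry _)).
  - exact: (le_lt_trans (probability_le1 _ _) (ltry _)).
- move=> n; apply: (le_lt_trans (probability_le1 _ _) (ltry _)).
  exact: measurable_itv.
Qed.

(** * The probability integral transform *)

Section probability_integral_transform.
Context {R : realType} (G : cumulativeBounded (0 : R) (1 : R)).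
Let muG := lebesgue_stieltjes_measure G.

Lemma lebesgue_stieltjes_ray t : muG `]-oo, t]%classic = (G t)%:E.
Proof. by rewrite -cdf_lebesgue_stieltjes_id. Qed.

Lemma cumulative_ge0 t : 0 <= G t.
Proof. by rewrite -lee_fin -lebesgue_stieltjes_ray. Qed.

Lemma cumulative_le1 t : G t <= 1.
Proof.
by rewrite -lee_fin -lebesgue_stieltjes_ray; exact: probability_le1.
Qed.

Lemma cumulative_le s t : s <= t -> G s <= G t.
Proof. exact: cumulative_is_nondecreasing. Qed.

Lemma cumulative_measurable :
  measurable_fun setT (G : measurableTypeR R -> measurableTypeR R).
Proof.
apply: measurable_realfun.nondecreasing_measurable => //.
exact: cumulative_is_nondecreasing.
Qed.

Context (G_cont : continuous G).

Lemma cumulative_surj x : 0 < x < 1 -> exists t, G t = x.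
Proof.
move=> /andP[x0 x1].
have [s Gs] := filter_ex (cvgr_lt _ (cumulativeNy G) _ x0).
have [t Gt] := filter_ex (cvgr_gt _ (cumulativey G) _ x1).
have st : s <= t.
  rewrite leNgt; apply/negP => /ltW /cumulative_le.
  by rewrite leNgt (lt_trans Gs Gt).
have [||r _ Gr] := @IVT R G s t x st; last by exists r.
- exact: continuous_subspaceT.
- by rewrite ge_min le_max (ltW Gs) (ltW Gt) orbT.
Qed.

(** The clamped value is the uniform cdf on the unit interval. For [0 < x < 1], the sublevel set
    contains the ray up to any [s] with [G s = x], and lies in the ray up to any [s] with
    [G s = y > x]; letting [y] decrease to [x] closes the gap, even if [G] is flat at level [x]. *)
Lemma lebesgue_stieltjes_sublevel x :
  muG (G @^-1` `]-oo, x]) = (Num.min (Num.max x 0) 1)%:E.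
Proof.
have mI t : measurable (`]-oo, t]%classic : set (measurableTypeR R)).
  exact: measurable_itv.
have mG : measurable (G @^-1` `]-oo, x] : set (measurableTypeR R)).
  by rewrite -[X in measurable X]setTI; apply: cumulative_measurable.
have [x1|x1] := leP 1 x.
  rewrite max_l ?(le_trans _ x1) // min_r // -(probability_setT muG).
  congr (muG _); apply/seteqP; split => // t _ /=.
  by rewrite in_itv /= (le_trans (cumulative_le1 t)).
(* If [G t <= x < y = G s], then [t] lies to the left of [s]. *)
have upper y : x < y -> 0 < y < 1 -> (muG (G @^-1` `]-oo, x]) <= y%:E)%E.
  move=> xy /cumulative_surj[s Gs].
  rewrite -Gs -lebesgue_stieltjes_ray; apply: le_measure; rewrite ?inE //.
  move=> t /=; rewrite !in_itv /= => Gt; rewrite leNgt; apply/negP => /ltW.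
  move=> /cumulative_le.
  by rewrite Gs leNgt (le_lt_trans Gt).
have [x0|x0] := leP x 0.
  rewrite min_l //; apply/eqP; rewrite eq_le measure_ge0 andbT.
  apply/lee_addgt0Pr => e e0; rewrite add0e.
  (* The cap [2^-1] keeps the level strictly below 1, where [G] is known to attain it. *)
  have e1 : 0 < Num.min e 2^-1 by rewrite lt_min e0 invr_gt0 ltr0n.
  apply: (@le_trans _ _ (Num.min e 2^-1)%:E); last by rewrite lee_fin ge_min lexx.
  apply: upper; first exact: le_lt_trans e1.
  by rewrite e1 gt_min (_ : 2^-1 < 1) ?orbT // invf_lt1 ?ltr1n.
rewrite min_l ?(ltW x1) //; apply/eqP; rewrite eq_le; apply/andP; split.
  apply/lee_addgt0Pr => e e0.
  (* The midpoint of [x] and 1 keeps [y] below 1, and [x + e] keeps it within [e] of [x]. *)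
  pose y := Num.min (x + e) ((x + 1) / 2).
  have xy : x < y by rewrite lt_min; apply/andP; split; lra.
  apply: (@le_trans _ _ y%:E); last by rewrite lee_fin ge_min lexx.
  apply: upper => //; rewrite (lt_trans x0 xy) /= gt_min.
  by apply/orP; right; lra.
have [|s Gs] := @cumulative_surj x; first by rewrite x0 x1.
rewrite -[in leLHS]Gs -lebesgue_stieltjes_ray.
apply: le_measure; rewrite ?inE //.
move=> t /=; rewrite !in_itv /= => ts.
by rewrite -Gs; exact: cumulative_le.
Qed.

Lemma uniform_prob01_ray x :
  uniform_prob (@ltr01 R) `]-oo, x]%classic = (Num.min (Num.max x 0) 1)%:E.
Proof.
rewrite /uniform_prob integral_uniform_pdf.
have -> : `]-oo, x] `&` `[0, 1] = `[0, Num.min x 1]%classic :> set R.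
  apply/seteqP; split => t /=; rewrite !in_itv /= le_min.
    by move=> [-> /andP[-> ->]].
  by move=> /andP[-> /andP[-> ->]].
rewrite (eq_integral (cst 1%E)); last first.
  move=> t; rewrite inE /= in_itv /= le_min => /andP[t0 /andP[_ t1]].
  by rewrite /uniform_pdf t0 t1 subr0 invr1.
rewrite integral_cst ?mul1e; last exact: measurable_itv.
rewrite /= lebesgue_measure_itv /= lte_fin lt_min ltr01 andbT.
by have [x0|x0] := ltP 0 x; rewrite ?sube0 // min_l.
Qed.

Lemma pushforward_cumulativeE A : measurable A ->
  muG (G @^-1` A) = uniform_prob (@ltr01 R) A.
Proof.
move=> mA.
pose G_mfun : {RV muG >-> measurableTypeR R} :=
  HB.pack (G : measurableTypeR R -> measurableTypeR R)
    (isMeasurableFun.Build _ _ _ _ _ cumulative_measurable).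
apply: (@eq_probability_ray R (distribution muG G_mfun)
  (uniform_prob (@ltr01 R))) => // x.
exact: etrans (lebesgue_stieltjes_sublevel x) (esym (uniform_prob01_ray x)).
Qed.

(** The pushforward is uniform, hence absolutely continuous with respect to Lebesgue measure, so
    even an interval on which [G] is flat has no mass. *)
Lemma cumulative_fiber_null x : muG (G @^-1` [set x]) = 0%E.
Proof.
rewrite pushforward_cumulativeE; last exact: measurable_set1.
have /null_content_dominatesP := dominates_uniform_prob (@ltr01 R).
by apply; [exact: measurable_set1|exact: lebesgue_measure_set1].
Qed.

Lemma ge0_integral_cumulative (h : R -> \bar R) :
  measurable_fun setT (h : measurableTypeR R -> \bar R) ->
  (forall u, (0 <= h u)%E) ->
  (\int[muG]_t h (G t) = \int[lebesgue_measure]_(u in `[0%R, 1%R]) h u)%E.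
Proof.
move=> mh h0.
rewrite -[LHS](@ge0_integral_pushforward _ _ _ _ _ _
  cumulative_measurable _ setT) //.
rewrite (eq_measure_integral (uniform_prob (@ltr01 R))); last first.
- by move=> mG A mA _; exact: pushforward_cumulativeE.
- exact: cumulative_measurable.
- by rewrite integral_uniform // subr0 invr1 mul1e.
Qed.

End probability_integral_transform.

(** * Integrals of the kernel over the pieces of a subdivision *)

Section integrals.
Context {R : realType}.
Local Notation mu := (@lebesgue_measure R).

(** The pieces are open on the right so that consecutive ones are disjoint and fit a
    right-continuous step function. The case [a = b] is included because [G] may take the same value
    at two order statistics. *)
Lemma integral_itvco_FTC (f F : R -> R) (a b : R) : a <= b ->
  {in `[a, b], continuous f} ->
  (forall x, x \in `[a, b] -> is_derive x 1 F (f x)) ->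
  (\int[mu]_(x in `[a, b[) (f x)%:E = (F b - F a)%:E)%E.
Proof.
rewrite le_eqVlt => /predU1P[<- _ _|ab cf dF].
  by rewrite set_itvco0 // integral_set0 subrr.
have cFt x : x \in `[a, b] -> {for x, continuous F}.
  by move=> xab; have [/derivable1_diffP/differentiable_continuous] := dF x xab.
have cw g : {in `[a, b], continuous g} ->
    {within `[a, b], continuous (g : R -> R)}.
  move=> cg; apply: continuous_in_subspaceT => x; rewrite inE; exact: cg.
have mf : measurable_fun (`[a, b] : set R) f.
  by apply: subspace_continuous_measurable_fun => //; exact: cw.
have ab' x : x \in `]a, b[ -> x \in `[a, b].
  by rewrite !in_itv /= => /andP[/ltW -> /ltW ->].
rewrite integral_itv_bndo_bndc; last first.
  apply/measurable_EFinP; apply: measurable_funS mf.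
    exact: measurable_itv.
  by apply: subset_itvl; rewrite bnd_simp.
rewrite (@continuous_FTC2 _ f F) //; first exact: cw.
- split.
  + by move=> x /ab' /dF[].
  + by apply: cvg_at_right_filter; apply: cFt; rewrite in_itv /= lexx ltW.
  + by apply: cvg_at_left_filter; apply: cFt; rewrite in_itv /= lexx ltW.
- by move=> x /ab' /dF ?; rewrite derive1E derive_val.
Qed.

Lemma ge0_integral_itvco_split (h : R -> \bar R) (x : nat -> R) n :
  measurable_fun setT h -> (forall u, (0 <= h u)%E) ->
  {homo x : i j / (i <= j)%N >-> i <= j} ->
  (\int[mu]_(u in `[x 0%N, x n[) h u =
   \sum_(0 <= i < n) \int[mu]_(u in `[x i, x i.+1[) h u)%E.
Proof.
move=> mh h0 nd; elim: n => [|n IH].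
  by rewrite big_geq // set_itvco0 // integral_set0.
rewrite big_nat_recr //= -IH.
rewrite (@itv_bndbnd_setU _ _ _ (BLeft (x n))) ?bnd_simp ?nd //.
rewrite ge0_integral_setU //; [exact: measurable_funTS|].
apply/disj_setPS => t [] /=; rewrite !in_itv /= => /andP[_ tx] /andP[xt _].
by rewrite ltNge xt in tx.
Qed.

(* A primitive of [u |-> (c - u)^2 / (u (1 - u))]; the junk value [ln 0] gets
   coefficient [c ^+ 2 = 0] at [u = 0] if [c = 0], and [- (1 - c) ^+ 2 = 0] at
   [u = 1] if [c = 1]. *)
Definition ad_primitive (c u : R) : R :=
  c ^+ 2 * (ln u - ln (1 - u)) + 2 * c * ln (1 - u) - ln (1 - u) - u.

(* The absolute value makes this nonnegative also outside [0 <= u <= 1]. *)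
Definition ad_kernel (c u : R) : \bar R :=
  ((c - u) ^+ 2)%:E / `|u * (1 - u)|%:E.

Lemma ad_kernelE (c u : R) : 0 < u < 1 ->
  ad_kernel c u = ((c - u) ^+ 2 / (u * (1 - u)))%:E.
Proof.
move=> /andP[u0 u1]; have u1' : 0 < 1 - u by rewrite subr_gt0.
by rewrite /ad_kernel gtr0_norm ?mulr_gt0 // inver gt_eqF ?mulr_gt0 //.
Qed.

Lemma is_derive_ln1B (u : R) : u < 1 ->
  is_derive u 1 (fun v : R => ln (1 - v)) (- (1 - u)^-1).
Proof.
rewrite -subr_gt0 => u1.
have d1 : is_derive u 1 (fun v : R => 1 - v) (- 1).
  apply: is_derive_eq (is_deriveB (is_derive_cst _ _ _) (is_derive_id _ _)) _.
  by rewrite sub0r.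
rewrite -[- (1 - u)^-1]mulrN1.
exact: (@is_derive1_comp R (@ln R) (fun v => 1 - v) u _ _
  (is_derive1_ln u1) d1).
Qed.

(** A linear combination of functions is the form to which the derivation rules apply. *)
Lemma ad_primitiveE (c : R) : ad_primitive c =
  (c ^+ 2 \*: @ln R)
  + ((2 * c - 1 - c ^+ 2) \*: (fun v : R => ln (1 - v))) - id.
Proof.
by apply/funext => v; rewrite /ad_primitive !fctE /= -![_ *: _]/(_ * _); ring.
Qed.

Lemma integral_ad_kernel_mid (c a b : R) : 0 < a -> a <= b -> b < 1 ->
  (\int[mu]_(u in `[a, b[) ad_kernel c u =
   (ad_primitive c b - ad_primitive c a)%:E)%E.
Proof.
move=> a0 ab b1.
have u01 (u : R) : u \in `[a, b] -> 0 < u /\ 0 < 1 - u.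
  rewrite in_itv /= => /andP[au ub].
  by rewrite subr_gt0 (lt_le_trans a0) // (le_lt_trans ub).
pose f (u : R) : R := (c - u) ^+ 2 / (u * (1 - u)).
rewrite (@eq_integral _ (measurableTypeR R) _ _ _ (fun u => (f u)%:E)); last first.
  move=> u; rewrite inE => /subset_itv_co_cc /u01[u0 u1].
  by rewrite ad_kernelE // u0 -subr_gt0.
apply: (@integral_itvco_FTC f) => // u /u01[u0 u1].
- apply: (@continuousM R R (fun v => (c - v) ^+ 2)).
    apply: (@continuous_comp R R R (fun v => c - v) (fun v => v ^+ 2));
      last exact: exprn_continuous.
    by apply: (@continuousB R R R (cst c)); [exact: cst_continuous|].
  apply: continuousV; first by rewrite mulf_neq0 ?gt_eqF.
  apply: (@continuousM R R id) => //.
  by apply: (@continuousB R R R (cst 1)); [exact: cst_continuous|].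
- have u1' : u < 1 by rewrite -subr_gt0.
  rewrite ad_primitiveE.
  apply: is_derive_eq (is_deriveB (is_deriveD (is_deriveZ _ (is_derive1_ln u0))
    (is_deriveZ _ (is_derive_ln1B u1'))) (is_derive_id _ _)) _.
  by rewrite -![_ *: _]/(_ * _) /f; field; rewrite !gt_eqF.
Qed.

(** For [c = 0] a factor [u] cancels, which leaves [u / (1 - u)], continuous at 0. *)
Lemma integral_ad_kernel0 (b : R) : 0 <= b -> b < 1 ->
  (\int[mu]_(u in `[0%R, b[) ad_kernel 0 u =
   (ad_primitive 0 b - ad_primitive 0 0)%:E)%E.
Proof.
move=> b0 b1.
have u01 (u : R) : u \in `[0, b] -> 0 <= u /\ u < 1.
  by rewrite in_itv /= => /andP[-> /le_lt_trans ->].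
pose f (u : R) : R := u / (1 - u).
rewrite (@eq_integral _ (measurableTypeR R) _ _ _ (fun u => (f u)%:E)); last first.
  move=> u; rewrite inE => /subset_itv_co_cc /u01[].
  (* At [u = 0] the kernel is the extended quotient 0 / 0, which is 0 and agrees with [f 0]. *)
  rewrite le_eqVlt => /predU1P[<- _|u0 u1].
    by rewrite /ad_kernel subrr expr0n /= mul0e /f !mul0r.
  rewrite ad_kernelE ?u0 // /f; congr EFin.
  by field; rewrite subr_eq0 !gt_eqF.
apply: (@integral_itvco_FTC f) => // u /u01[u0 u1].
- apply: (@continuousM R R id) => //.
  apply: continuousV; first by rewrite subr_eq0 gt_eqF.
  by apply: (@continuousB R R R (cst 1)); [exact: cst_continuous|].
(* The term in [ln u] drops out, so the primitive is differentiable at 0 as well. *)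
- have -> : ad_primitive 0 = - (fun v : R => ln (1 - v)) - id.
    by apply/funext => v; rewrite /ad_primitive !fctE /=; ring.
  apply: is_derive_eq
    (is_deriveB (is_deriveN (is_derive_ln1B u1)) (is_derive_id _ _)) _.
  by rewrite /f; field; rewrite subr_eq0 gt_eqF.
Qed.

(** For [c = 1] a factor [1 - u] cancels, which leaves [(1 - u) / u], continuous at 1. The primitive
    reduces to [ln u - u]. *)
Lemma integral_ad_kernel1 (a : R) : 0 < a -> a <= 1 ->
  (\int[mu]_(u in `[a, 1%R[) ad_kernel 1 u =
   (ad_primitive 1 1 - ad_primitive 1 a)%:E)%E.
Proof.
move=> a0 a1.
have u01 (u : R) : u \in `[a, 1] -> 0 < u.
  by rewrite in_itv /= => /andP[/(lt_le_trans a0)].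
pose f (u : R) : R := (1 - u) / u.
rewrite (@eq_integral _ (measurableTypeR R) _ _ _ (fun u => (f u)%:E)); last first.
  move=> u; rewrite inE => /[dup] /subset_itv_co_cc /u01 u0.
  rewrite /= in_itv /= => /andP[_ u1].
  rewrite ad_kernelE ?u0 // /f; congr EFin.
  by field; rewrite subr_eq0 !gt_eqF.
apply: (@integral_itvco_FTC f) => // u /u01 u0.
- apply: (@continuousM R R (fun v => 1 - v)); last first.
    by apply: continuousV; rewrite ?gt_eqF.
  by apply: (@continuousB R R R (cst 1)); [exact: cst_continuous|].
- have -> : ad_primitive 1 = @ln R - id.
    by apply/funext => v; rewrite /ad_primitive !fctE /=; ring.
  apply: is_derive_eq (is_deriveB (is_derive1_ln u0) (is_derive_id _ _)) _.
  by rewrite /f; field; rewrite gt_eqF.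
Qed.

(** The real inverse is continuous off 0, and the extended inverse differs from it only at 0, where
    it is [+oo]. *)
Lemma measurable_inver d (T : measurableType d) (f : T -> R) :
  measurable_fun setT f -> measurable_fun setT (fun t => (f t)%:E^-1)%E.
Proof.
move=> mf.
have mV : measurable_fun setT (@GRing.inv R).
  have -> : [set: R] = [set~ 0] `|` [set 0] by rewrite setUC setUv.
  apply/measurable_funU; [exact: measurableC|exact: measurable_set1|].
  split; last exact: measurable_fun_set1.
  apply: open_continuous_measurable_fun.
    by apply: closed_openC; exact: closed_eq.
  by move=> x; rewrite inE => /eqP x0; exact: inv_continuous.
have -> : (fun t => (f t)%:E^-1)%E =
    (fun t => if f t == 0%R then +oo else ((f t)^-1)%:E)%E.
  by apply/funext => t; rewrite inver.
apply: measurable_fun_ifT.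
- exact: measurable_fun_eqr.
- exact: measurable_cst.
- by apply/measurable_EFinP; exact: measurableT_comp.
Qed.
End integrals.

(** * Algebra of the closed form *)

Lemma triangle_sqr (R : comNzRingType) (a : nat -> R) n :
  (\sum_(1 <= j < n.+1) a j) ^+ 2 =
  2 * (\sum_(1 <= j < n) \sum_(j.+1 <= k < n.+1) a j * a k)
  + \sum_(1 <= j < n.+1) a j ^+ 2.
Proof.
elim: n => [|n IH]; first by rewrite !big_geq // expr0n mulr0 addr0.
(* Passing to [n.+1] adds the pairs with [k = n.+1], one for each [j] up to [n]. *)
have -> : \sum_(1 <= j < n.+1) \sum_(j.+1 <= k < n.+2) a j * a k =
    \sum_(1 <= j < n) \sum_(j.+1 <= k < n.+1) a j * a k
    + (\sum_(1 <= j < n.+1) a j) * a n.+1.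
  (* The outer range may include [j = n], where the inner sum is empty. *)
  have -> : \sum_(1 <= j < n) \sum_(j.+1 <= k < n.+1) a j * a k =
      \sum_(1 <= j < n.+1) \sum_(j.+1 <= k < n.+1) a j * a k.
    case: n {IH} => [|n]; first by rewrite !big_geq.
    by rewrite [RHS]big_nat_recr //= [X in _ = _ + X]big_geq // addr0.
  rewrite mulr_suml -big_split /= big_nat [RHS]big_nat.
  by apply: eq_bigr => j /andP[_ jn]; rewrite big_nat_recr.
rewrite !(big_nat_recr n.+1 1) //= sqrrD IH; ring.
Qed.

Section algebra.
Context {R : realType}.

(** After the substitution [u = G t], the logarithms of the theorem are those taken with [id] in
    place of [G]. *)
Lemma ad_primitive_diff (c a b : R) : 0 < a < 1 -> 0 < b < 1 ->
  ad_primitive c b - ad_primitive c a =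
  c ^+ 2 * logC id a b + 2 * c * logCstar id a b - logCstar id a b + (a - b).
Proof.
move=> /andP[a0 a1] /andP[b0 b1].
have a1' : 0 < 1 - a by rewrite subr_gt0.
have b1' : 0 < 1 - b by rewrite subr_gt0.
rewrite /logC /logCstar !ln_div ?posrE ?mulr_gt0 // !lnM ?posrE //.
by rewrite /ad_primitive; ring.
Qed.

(** Squaring the partial sums [S i] produces the triangular sums. The linear terms of the middle
    pieces telescope to [x 1 - x N], which cancels against the end pieces: these are
    [- ln (1 - x 1) - x 1] for [c = 0] and [- 1 - ln (x N) + x N] for [c = 1]. *)
Lemma sum_ad_primitive (N : nat) (J' x : nat -> R) : (0 < N)%N ->
  (forall i, (1 <= i <= N)%N -> 0 < x i < 1) -> x 0%N = 0 -> x N.+1 = 1 ->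
  \sum_(1 <= j < N.+1) J' j = 1 ->
  let S i := \sum_(1 <= j < i.+1) J' j in
  let C i := logC id (x i) (x i.+1) in
  let Cs i := logCstar id (x i) (x i.+1) in
  \sum_(0 <= i < N.+1) (ad_primitive (S i) (x i.+1) - ad_primitive (S i) (x i)) =
  2 * (\sum_(1 <= i < N) \sum_(1 <= j < i) \sum_(j.+1 <= k < i.+1)
          J' j * J' k * C i)
   + \sum_(1 <= i < N) \sum_(1 <= j < i.+1) J' j ^+ 2 * C i
   + 2 * (\sum_(1 <= i < N) \sum_(1 <= j < i.+1) J' j * Cs i)
   - \sum_(1 <= i < N) Cs i
   - ln (x N * (1 - x 1%N))
   - 1.
Proof.
move=> N0 x01 x0 xN SN S C Cs.
have mid : \sum_(1 <= i < N)
      (ad_primitive (S i) (x i.+1) - ad_primitive (S i) (x i)) =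
    2 * (\sum_(1 <= i < N) \sum_(1 <= j < i) \sum_(j.+1 <= k < i.+1)
          J' j * J' k * C i)
   + \sum_(1 <= i < N) \sum_(1 <= j < i.+1) J' j ^+ 2 * C i
   + 2 * (\sum_(1 <= i < N) \sum_(1 <= j < i.+1) J' j * Cs i)
   - \sum_(1 <= i < N) Cs i + (x 1%N - x N).
  transitivity (\sum_(1 <= i < N)
      (2 * (\sum_(1 <= j < i) \sum_(j.+1 <= k < i.+1) J' j * J' k * C i)
       + \sum_(1 <= j < i.+1) J' j ^+ 2 * C i
       + 2 * (\sum_(1 <= j < i.+1) J' j * Cs i) - Cs i - (x i.+1 - x i))); last first.
    by rewrite !big_split /= !sumrN -!mulr_sumr telescope_sumr // opprB.
  rewrite big_nat [RHS]big_nat; apply: eq_bigr => i /andP[i1 iN].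
  rewrite ad_primitive_diff; [|by apply: x01; rewrite i1 ltnW|by apply: x01].
  under [X in 2 * X + _]eq_bigr => j _ do rewrite -mulr_suml.
  rewrite -/(C i) -/(Cs i) triangle_sqr -!mulr_suml -/(S i); ring.
rewrite big_nat_recr //= big_ltn //= mid x0 xN.
have -> : S 0%N = 0 by rewrite /S big_geq.
have -> : S N = 1 by [].
have /andP[x1_gt0 x1_lt1] : 0 < x 1%N < 1 by apply: x01; rewrite N0.
have /andP[xN_gt0 xN_lt1] : 0 < x N < 1 by apply: x01; rewrite N0 leqnn.
rewrite lnM ?posrE ?subr_gt0 // /ad_primitive !subr0 subrr ln1 (@ln0 _ 0) //; ring.
Qed.
End algebra.

(** * Reduction of the distance to an integral over the unit interval *)

Section discrete.
Context {R : realType} (N : nat).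
Implicit Types (J y : 'I_N -> R).

Lemma cdf_discrete_distribution J y t :
  cdf_of (discrete_distribution J y) t = \sum_(i < N) J i * (y i <= t)%R%:R.
Proof.
rewrite /cdf_of /discrete_distribution.
under eq_bigr do rewrite diracE -EFinM.
by rewrite sumEFin /=; apply: eq_bigr => i _; rewrite mem_setE in_itv.
Qed.

Lemma measurable_step_sum J y :
  measurable_fun setT
    (fun t : measurableTypeR R => \sum_(i < N) J i * (y i <= t)%R%:R).
Proof.
apply: measurable_sum => i; apply: measurable_funM => //.
have -> : (fun t : measurableTypeR R => (y i <= t)%R%:R) =
    (\1_(`[y i, +oo[%classic) : R -> R).
  by apply/funext => t; rewrite indicE mem_setE in_itv /= andbT.
by apply: measurable_indic; exact: measurable_itv.
Qed.

Lemma measurable_ad_kernel d (T : measurableType d) (c g : T -> R) :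
  measurable_fun setT c -> measurable_fun setT g ->
  measurable_fun setT (fun t => ad_kernel (c t) (g t)).
Proof.
move=> mc mg; apply: emeasurable_funM.
  apply/measurable_EFinP; apply: measurable_funX; exact: measurable_funB.
apply: measurable_inver; apply: measurableT_comp => //.
by apply: measurable_funM => //; exact: measurable_funB.
Qed.

Lemma ad_kernel_ge0 (c u : R) : (0 <= ad_kernel c u)%E.
Proof. by rewrite /ad_kernel mule_ge0 ?inve_ge0 ?lee_fin ?sqr_ge0. Qed.

(** The cdf tests [y i <= t], while the change of variables needs a function of [G t], hence the
    test [G (y i) <= G t]. The two disagree only if [t < y i] and [G t = G (y i)], that is, inside
    one of finitely many fibers of [G], all of them null. *)
Lemma anderson_darling_discrete (G : cumulativeBounded (0 : R) (1 : R)) J y :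
  continuous G ->
  anderson_darling (cdf_of (discrete_distribution J y)) G =
  (\int[lebesgue_measure]_(u in `[0%R, 1%R])
     ad_kernel (\sum_(i < N) J i * (G (y i) <= u)%R%:R)%R u)%E.
Proof.
move=> G_cont; rewrite -(ge0_integral_cumulative G_cont); first last.
- by move=> u; exact: ad_kernel_ge0.
- by apply: measurable_ad_kernel => //; exact: measurable_step_sum.
rewrite /anderson_darling.
transitivity (\int[lebesgue_stieltjes_measure G]_t
    ad_kernel (\sum_(i < N) J i * (y i <= t)%R%:R)%R (G t))%E.
  apply: eq_integral => t _; rewrite cdf_discrete_distribution /ad_kernel.
  by rewrite ger0_norm // mulr_ge0 ?subr_ge0 ?cumulative_ge0 ?cumulative_le1.
apply: ge0_ae_eq_integral => //.
- apply: measurable_ad_kernel; first exact: measurable_step_sum.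
  exact: cumulative_measurable.
- apply: measurable_ad_kernel; last exact: cumulative_measurable.
  apply: measurableT_comp (measurable_step_sum _ _) _.
  exact: cumulative_measurable.
- by move=> t _; exact: ad_kernel_ge0.
- by move=> t _; exact: ad_kernel_ge0.
have neq_fiber : {ae lebesgue_stieltjes_measure G,
    forall t, forall i, G t != G (y i)}.
  apply: filter_forall => i.
  exists (G @^-1` [set G (y i)]); split.
  - by rewrite -[X in measurable X]setTI; apply: cumulative_measurable.
  - exact: cumulative_fiber_null.
  - by move=> t /= /negP/negPn/eqP.
have ae_filter := ae_filter_ringOfSetsType (lebesgue_stieltjes_measure G).
apply: (@filterS _ _ ae_filter _ _ _ neq_fiber) => t neq _.
congr ad_kernel; apply: eq_bigr => i _; congr (_ * (nat_of_bool _)%:R).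
apply/idP/idP => [/cumulative_le //|Gt].
rewrite leNgt; apply/negP => /ltW /(cumulative_le G) Gt'.
by have := neq i; rewrite eq_le Gt' Gt.
Qed.
End discrete.

(** * Order statistics and their jumps *)

Section order_statistics.
Context {R : realType} (N : nat).
Implicit Types (J y : 'I_N -> R).

Lemma order_stat_le y i j : (1 <= i)%N -> (i <= j)%N -> (j <= N)%N ->
  order_stat y i <= order_stat y j.
Proof.
case: i j => [//|i] [//|j] _ ij jN; rewrite /order_stat /=.
have sz : size (sort <=%R [seq y j | j <- enum 'I_N]) = N.
  by rewrite size_sort size_map size_enum_ord.
apply: (sorted_leq_nth le_trans le_refl) => //; rewrite ?inE ?sz //.
- by apply: sort_sorted; exact: le_total.
- exact: leq_ltn_trans jN.
Qed.

(** Reindexing by the sorting permutation suffices, so any admissible [J'] will do under ties. A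
    constant [phi] gives the total mass, and a threshold indicator gives the step function. *)
Lemma associated_jumps_sum J y (J' : nat -> R) (phi : R -> R) :
  associated_jumps J y J' ->
  \sum_(i < N) J i * phi (y i) =
  \sum_(1 <= j < N.+1) J' j * phi (order_stat y j).
Proof.
move=> [s Hs]; rewrite (reindex_inj (@perm_inj _ s)) big_add1 big_mkord /=.
by apply: eq_bigr => j _; have [<- ->] := Hs j.
Qed.
End order_statistics.

(** * The Anderson-Darling formula *)

Theorem lemma1 (d : measure_display) (T : measurableType d) (R : realType)
    (P : probability T R) (N : nat) (N_gt0 : (0 < N)%N)
    (H : probability R R)
    (G : cumulativeBounded (0 : R) (1 : R)) (G_cont : continuous G)
    (Y : 'I_N -> {RV P >-> R}) (Y_iid : iid_from Y H)
    (J : 'I_N -> {RV P >-> R})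
    (J_ge0 : forall i w, 0 <= J i w)
    (J_sum1 : forall w, \sum_(i < N) J i w = 1) (w : T)
    (J' : nat -> R)
    (J'_assoc : associated_jumps (fun i => J i w) (fun i => Y i w) J') :
  let Yo := order_stat (fun i => Y i w) in
  let C i := logC G (Yo i) (Yo i.+1) in
  let Cs i := logCstar G (Yo i) (Yo i.+1) in
  let PN := discrete_distribution (fun i => J i w) (fun i => Y i w) in
  0 < G (Yo 1%N) -> G (Yo N) < 1 ->
  anderson_darling (cdf_of PN) G =
  (2 * (\sum_(1 <= i < N) \sum_(1 <= j < i) \sum_(j.+1 <= k < i.+1)
          J' j * J' k * C i)
   + \sum_(1 <= i < N) \sum_(1 <= j < i.+1) J' j ^+ 2 * C i
   + 2 * (\sum_(1 <= i < N) \sum_(1 <= j < i.+1) J' j * Cs i)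
   - \sum_(1 <= i < N) Cs i
   - ln (G (Yo N) * (1 - G (Yo 1%N)))
   - 1)%:E.
Proof.
move=> Yo C Cs PN G1_gt0 GN_lt1.
(* The values of [G] at the order statistics, with 0 and 1 added as end points, cut the unit
   interval into pieces numbered from 0 to [N]. *)
pose x i := if (i == 0)%N then 0 else if (i <= N)%N then G (Yo i) else 1.
have xE i : (1 <= i <= N)%N -> x i = G (Yo i).
  by case: i => [//|i] /= iN; rewrite /x iN.
have xN1 : x N.+1 = 1 by rewrite /x /= ltnn.
have x_nd : {homo x : i j / (i <= j)%N >-> i <= j}.
  move=> [|i] [|j] //; rewrite /x /= => ij.
    by case: ifP => _; rewrite ?cumulative_ge0 ?ler01.
  case: ifPn => [iN|iN]; case: ifPn => [jN|jN].
  - by apply: cumulative_le; exact: order_stat_le.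
  - exact: cumulative_le1.
  - by rewrite (leq_trans ij jN) in iN.
  - by [].
have x01 i : (1 <= i <= N)%N -> 0 < x i < 1.
  move=> /[dup] iN /andP[i1 i2]; rewrite xE //; apply/andP; split.
    by apply: lt_le_trans G1_gt0 _; apply: cumulative_le; exact: order_stat_le.
  by apply: le_lt_trans GN_lt1; apply: cumulative_le; exact: order_stat_le.
pose S i := \sum_(1 <= j < i.+1) J' j.
have SN : S N = 1.
  rewrite -(J_sum1 w).
  have := associated_jumps_sum (cst 1) J'_assoc.
  under eq_bigr do rewrite mulr1.
  under [X in _ = X -> _]eq_bigr do rewrite mulr1.
  by move=> ->.
pose psi u := \sum_(i < N) J i w * (G (Y i w) <= u)%R%:R.
(* On the piece from [x i] to [x i.+1], exactly the first [i] order statistics pass the test. A tie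
   makes the piece empty and the claim vacuous. *)
have psiE i u : (i <= N)%N -> x i <= u -> u < x i.+1 -> psi u = S i.
  move=> iN xu ux; rewrite /psi.
  rewrite (associated_jumps_sum (fun t => (G t <= u)%R%:R) J'_assoc).
  rewrite (big_cat_nat (n := i.+1)) //= [X in _ + X](_ : _ = 0) ?addr0;
    last first.
    rewrite big_nat big1 // => j /andP[ij jN].
    rewrite -/(Yo j) -xE; last by rewrite (leq_trans _ ij).
    by rewrite leNgt (lt_le_trans ux (x_nd _ _ ij)) mulr0.
  rewrite big_nat /S [RHS]big_nat; apply: eq_bigr => j /andP[j1 ji].
  rewrite -/(Yo j) -xE; last by rewrite j1 (leq_trans _ iN).
  by rewrite (le_trans (x_nd j i ji) xu) mulr1.
rewrite anderson_darling_discrete //.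
have mh : measurable_fun setT (fun u : measurableTypeR R => ad_kernel (psi u) u).
  by apply: measurable_ad_kernel => //; exact: measurable_step_sum.
have h0 u : (0 <= ad_kernel (psi u) u)%E by exact: ad_kernel_ge0.
rewrite -integral_itv_bndo_bndc; last exact: measurable_funTS.
have split_x := ge0_integral_itvco_split N.+1 mh h0 x_nd.
rewrite [x 0%N]/x /= xN1 in split_x; rewrite [LHS]split_x {split_x}.
rewrite (eq_big_nat _ _ (F2 := fun i =>
    (ad_primitive (S i) (x i.+1) - ad_primitive (S i) (x i))%:E)); last first.
  move=> i /andP[_ iN].
  rewrite (@eq_integral _ (measurableTypeR R) _ _ _ (ad_kernel (S i))); last first.
    move=> u; rewrite inE /= in_itv /= => /andP[xu ux].
    by rewrite (psiE i).
  (* The first piece has [c = 0], the last has [c = S N = 1], and the others stay away from both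
     singularities. *)
  case: i iN => [_|i iN].
    rewrite /S big_geq //.
    apply: integral_ad_kernel0; first exact: (x_nd 0%N 1%N).
    by have /andP[] : 0 < x 1%N < 1 by apply: x01; rewrite N_gt0.
  have /andP[xi_gt0 xi_lt1] : 0 < x i.+1 < 1 by apply: x01.
  move: iN; rewrite ltnS leq_eqVlt => /predU1P[iN|iN].
    rewrite iN in xi_gt0 xi_lt1 *.
    by rewrite SN xN1; apply: integral_ad_kernel1 => //; exact: ltW.
  apply: integral_ad_kernel_mid => //; first exact: x_nd.
  by have /andP[] : 0 < x i.+2 < 1 by apply: x01.
rewrite sumEFin sum_ad_primitive //.
(* For these indices neither [x i] nor [x i.+1] is one of the added end points. *)
have xE_mid i : (1 <= i < N)%N -> x i = G (Yo i) /\ x i.+1 = G (Yo i.+1).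
  by move=> /andP[i1 iN]; split; apply: xE; rewrite // i1 ltnW.
have logCE i : (1 <= i < N)%N -> logC id (x i) (x i.+1) = C i.
  by move=> /xE_mid[xi xi1]; rewrite /logC xi xi1.
have logCsE i : (1 <= i < N)%N -> logCstar id (x i) (x i.+1) = Cs i.
  by move=> /xE_mid[xi xi1]; rewrite /logCstar xi xi1.
rewrite (xE N) ?N_gt0 ?leqnn // (xE 1%N) //.
congr ((2 * _ + _ + 2 * _ - _ - _ - _)%:E); apply: eq_big_nat => i iN.
- by rewrite logCE.
- by rewrite logCE.
- by rewrite logCsE.
- by rewrite logCsE.
Qed.
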